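(* Let $W_{1,n-1}$ be the wheel graph of order $n\ge 7$. If $k$ is even and $4\le k<n-1$, then $\operatorname{msad}_k(W_{1,n-1})=\frac{k+2}{2}$ if $n\ge \frac{5k+2}{2}$; $\operatorname{msad}_k(W_{1,n-1})=n-k$ if $\frac{3k+2}{2}\le n<\frac{5k+2}{2}$; and $\operatorname{msad}_k(W_{1,n-1})=\infty$ otherwise. If $k$ is odd and $5\le k<n-1$, then, writing $t$ for the remainder of dividing $n-1-k$ by $3$, $\operatorname{msad}_k(W_{1,n-1})=\min\left\{\left\lfloor\frac{n-1-k}{3}\right\rfloor+t+1,\ \frac{3k+3}{2}\right\}$ if $n\ge\frac{5k+5}{2}$; $\operatorname{msad}_k(W_{1,n-1})=n-k$ if $2k<n<\frac{5k+5}{2}$; and $\operatorname{msad}_k(W_{1,n-1})=\infty$ otherwise.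
   Context: The wheel graph $W_{1,n-1}$ has vertex set $\{0,1,\dots,n-1\}$, where vertices $1,\dots,n-1$ induce the cycle $C_{n-1}$ and vertex $0$ is adjacent to all of $1,\dots,n-1$. For a connected graph $G$, $S\subseteq V(G)$ and $v\in V(G)$, $m(v|S)$ is the multiset $\{\!\{d_G(v,s): s\in S\}\!\}$ of shortest-path distances. A nonempty set $S\subsetneq V(G)$ is a $k$-multiset antiresolving set ($k$-MARS) if $k$ equals the minimum size of an equivalence class of the relation on $V(G)\setminus S$ given by $u\sim v \iff m(u|S)=m(v|S)$. $\operatorname{msad}_k(G)$ is the minimum cardinality of a $k$-MARS of $G$, with $\operatorname{msad}_k(G)=\infty$ if $G$ has no $k$-MARS. *)

(* Defs.v *)
From mathcomp Require Import all_boot.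

Set Implicit Arguments.
Unset Strict Implicit.
Unset Printing Implicit Defensive.

(* A finite simple graph is a symmetric irreflexive relation e on a finType. *)
Section GraphNotions.
Variables (T : finType) (e : rel T).

Definition has_walk (d : nat) (u v : T) : bool :=
  [exists p : d.-tuple T, path e u p && (last u p == v)].

(* In a connected graph the least walk length is below #|T|; the default value
   #|T| is only reached when v is not reachable from u. *)
Definition dist (u v : T) : nat :=
  \big[minn/#|T|]_(d < #|T| | has_walk d u v) d.

(* The multiset m(v|S), as a list to be compared up to perm_eq. *)
Definition mdist (S : {set T}) (v : T) : seq nat := [seq dist v s | s in S].

Definition msim (S : {set T}) : rel T :=
  [rel u v | perm_eq (mdist S u) (mdist S v)].

Definition mclasses (S : {set T}) : {set {set T}} :=
  equivalence_partition (msim S) (~: S).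

(* The default #|T| of the minimum is harmless: for a proper subset S there is
   at least one class, and every class has at most #|T| elements. *)
Definition is_kMARS (k : nat) (S : {set T}) : bool :=
  [&& S != set0, S \proper [set: T]
    & k == \big[minn/#|T|]_(C in mclasses S) #|C|].

(* None stands for infinity. *)
Definition msad (k : nat) : option nat :=
  if [exists S, is_kMARS k S]
  then Some (\big[minn/#|T|]_(S | is_kMARS k S) #|S|)
  else None.

End GraphNotions.

(* W_{1,n-1} on {0, ..., n-1}: hub 0, rim cycle 1, 2, ..., n-1, 1. *)
Definition cycle_next (n i j : nat) : bool :=
  [&& 0 < i, 0 < j & (j == i.+1) || (i == n.-1) && (j == 1)].

Definition wheel (n : nat) : rel 'I_n :=
  [rel i j : 'I_n | (i != j) &&
    [|| i == 0 :> nat, j == 0 :> nat, cycle_next n i j | cycle_next n j i]].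
Arguments wheel n _ _ : clear implicits.

(* Main.v *)
Require Import Defs.
From mathcomp Require Import all_boot zify.

Set Implicit Arguments.
Unset Strict Implicit.
Unset Printing Implicit Defensive.

(** A wheel has diameter 2, so two vertices outside S are equivalent iff they
have equally many neighbours in S. If the hub is not in S, then its class lies
in the neighbourhood of any s in S, hence has at most 3 elements; so k >= 4
forces the hub into S, and the classes are given by the number 0, 1 or 2 of rim
neighbours in S. The rest of the rim splits into gaps between elements of S: a
gap of length 1 is one vertex with 2 neighbours, a longer gap has two vertices
with 1 neighbour and otherwise vertices with none. With p long gaps, q short
gaps and r vertices without rim neighbour, the class sizes are 2p, q, r, and
the possible values are exactly those with n = |S| + 2p + q + r, p + q < |S|
and r > 0 -> p > 0. What remains is linear arithmetic. *)

(** * Preliminaries on minima and on lists over {1, 2} *)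

Lemma bigminn_le (I : eqType) (r : seq I) (P : pred I) (F : I -> nat) d i :
  i \in r -> P i -> \big[minn/d]_(j <- r | P j) F j <= F i.
Proof.
elim: r => [//|j r IH]; rewrite inE big_cons => /predU1P[<- ->|ir Pi].
  exact: geq_minl.
by case: (P j); [apply: leq_trans (geq_minr _ _) _|]; apply: IH.
Qed.

Lemma bigminn_attained (I : eqType) (r : seq I) (P : pred I) (F : I -> nat) d :
  \big[minn/d]_(j <- r | P j) F j = d \/
  exists i, [/\ i \in r, P i & F i = \big[minn/d]_(j <- r | P j) F j].
Proof.
elim: r => [|j r IH]; first by left; rewrite big_nil.
rewrite big_cons; case: ifP => Pj; last first.
  case: IH => [|[i [ir Pi <-]]]; first by left.
  by right; exists i; rewrite inE ir orbT.
rewrite /minn; case: ifP => _; first by right; exists j; rewrite inE eqxx.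
case: IH => [|[i [ir Pi <-]]]; first by left.
by right; exists i; rewrite inE ir orbT.
Qed.

(** No value exceeds the default [d], so over a nonempty family the fold is the true minimum. *)
Lemma bigminn_eqP (I : finType) (P : pred I) (F : I -> nat) d k :
  (exists i, P i) -> (forall i, P i -> F i <= d) ->
  \big[minn/d]_(i | P i) F i = k <->
  (exists2 i, P i & F i = k) /\ (forall i, P i -> k <= F i).
Proof.
move=> [i0 Pi0] led.
have le i : P i -> \big[minn/d]_(i | P i) F i <= F i.
  by apply: bigminn_le; rewrite mem_index_enum.
split=> [<-|[[i Pi <-] leF]].
  split=> //; case: (bigminn_attained (index_enum I) P F d) => [eqd|].
    by exists i0 => //; apply/eqP; rewrite eqn_leq le // eqd led.
  by case=> i [_ Pi Fi]; exists i.
apply/eqP; rewrite eqn_leq le //=.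
case: (bigminn_attained (index_enum I) P F d) => [->|]; first exact: led.
by case=> j [_ Pj <-]; apply: leF.
Qed.

(** With the length fixed, the number of 1s determines the number of 2s. *)
Lemma perm_eq_12 (s t : seq nat) :
  {in s, forall x, (x == 1) || (x == 2)} -> {in t, forall x, (x == 1) || (x == 2)} ->
  size s = size t -> perm_eq s t = (count_mem 1 s == count_mem 1 t).
Proof.
move=> s12 t12 st; apply/idP/eqP => [/permP -> //|c1].
have c2 r : {in r, forall x, (x == 1) || (x == 2)} ->
    count_mem 2 r = size r - count_mem 1 r.
  move=> r12; rewrite -(count_predC (pred1 1) r) addKn.
  by apply: eq_in_count => x /r12 /= /orP[] /eqP->.
apply/allP => x; rewrite mem_cat => /orP[/s12|/t12] /orP[] /eqP-> /=;
  by rewrite ?c1 // !c2 // st c1.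
Qed.

(** * Antiresolving sets in graphs of diameter at most 2 *)

Section Diameter2.
Variables (T : finType) (e : rel T).
Implicit Types (S : {set T}) (u v : T).

Definition nbrs S v : nat := #|[set s in S | e v s]|.

Definition msize S v : nat := #|[set y | (y \notin S) && (nbrs S y == nbrs S v)]|.

Lemma has_walk0 u v : has_walk e 0 u v = (u == v).
Proof.
apply/existsP/idP => [[p]|uv]; first by rewrite tuple0.
by exists [tuple]; rewrite /= uv.
Qed.

Lemma has_walk1 u v : has_walk e 1 u v = e u v.
Proof.
apply/existsP/idP => [[p]|uv].
  by case: p => -[|x []] //= _; rewrite andbT => /andP[exu /eqP <-].
by exists [tuple v]; rewrite /= uv eqxx.
Qed.

Lemma has_walk2 u w v : e u w -> e w v -> has_walk e 2 u v.
Proof. by move=> uw wv; apply/existsP; exists [tuple w; v]; rewrite /= uw wv eqxx. Qed.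

Hypothesis card_gt2 : 2 < #|T|.
Hypothesis diam2 : forall u v, u != v -> ~~ e u v -> exists2 w, e u w & e w v.

(** [card_gt2] puts the walk lengths 1 and 2 within the range of the minimum in [dist]. *)
Lemma dist_diam2 u v : u != v -> dist e u v = if e u v then 1 else 2.
Proof.
move=> uv; apply/bigminn_eqP => [|i _|]; last 1 first.
- split=> [|[[|[|i]] lti]] /=; rewrite ?has_walk0 ?has_walk1 ?(negPf uv) //.
  + case: ifP => euv; first by exists (Ordinal (ltnW card_gt2)); rewrite ?has_walk1.
    have [w uw wv] := diam2 uv (negbT euv).
    by exists (Ordinal card_gt2) => //; apply: has_walk2 uw wv.
  + by move->.
  + by case: ifP.
- case euv: (e u v); first by exists (Ordinal (ltnW card_gt2)); rewrite has_walk1.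
  have [w uw wv] := diam2 uv (negbT euv).
  by exists (Ordinal card_gt2); apply: has_walk2 uw wv.
- exact: ltnW.
Qed.

Lemma mdist_diam2 S v : v \notin S ->
  mdist e S v = [seq if e v s then 1 else 2 | s in S].
Proof.
move=> vS; apply/eq_in_map => s; rewrite mem_enum => sS.
by apply: dist_diam2; apply: contraNneq vS => ->.
Qed.

(** From outside [S] all distances to [S] are 1 or 2, and [nbrs] counts the 1s. *)
Lemma msim_diam2 S u v : u \notin S -> v \notin S ->
  msim e S u v = (nbrs S u == nbrs S v).
Proof.
move=> uS vS; rewrite /msim /= !mdist_diam2 //.
have c1 w : count_mem 1 [seq if e w s then 1 else 2 | s in S] = nbrs S w.
  rewrite count_map /nbrs -sum1_card -sum1_count big_enum_cond /=.
  by apply: eq_bigl => s; rewrite !inE; case: (e w s).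
have in12 w : {in [seq if e w s then 1 else 2 | s in S], forall x, (x == 1) || (x == 2)}.
  by move=> x /mapP[s _ ->]; case: ifP.
by rewrite perm_eq_12 ?c1 // !size_map.
Qed.

Lemma is_kMARSP k S : is_kMARS e k S <->
  [/\ S != set0, exists2 v, v \notin S & msize S v = k
    & forall v, v \notin S -> k <= msize S v].
Proof.
have clE x : x \notin S -> #|[set y in ~: S | msim e S x y]| = msize S x.
  move=> xS; apply: eq_card => y; rewrite !inE.
  by case yS: (y \in S) => //=; rewrite msim_diam2 ?yS // eq_sym.
have clP C : reflect (exists2 x, x \notin S & C = [set y in ~: S | msim e S x y])
                     (C \in mclasses e S).
  by apply: (iffP imsetP) => -[x xS ->]; exists x; rewrite ?inE // in xS *.
rewrite /is_kMARS [k == _]eq_sym properT; split.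
  case/and3P=> S0 ST /eqP; rewrite eqEsubset subsetT /= in ST.
  have [x _ xS] := subsetPn ST.
  case/bigminn_eqP => [|C _|]; last 1 first.
  - case=> -[C /clP[y yS ->] Ck] leC; split=> //.
      by exists y => //; rewrite -clE.
    by move=> z zS; rewrite -clE //; apply: leC; apply/clP; exists z.
  - by exists [set y in ~: S | msim e S x y]; apply/clP; exists x.
  - exact: max_card.
case=> S0 [x xS xk] lek; rewrite S0 /=; apply/andP; split.
  by apply: contraNneq xS => ->.
apply/eqP/bigminn_eqP => [|C _|]; last 1 first.
- split; first by exists [set y in ~: S | msim e S x y]; rewrite ?clE //; apply/clP; exists x.
  by move=> C /clP[y yS ->]; rewrite clE ?lek.
- by exists [set y in ~: S | msim e S x y]; apply/clP; exists x.
- exact: max_card.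
Qed.

Lemma msad_Some k s : (exists2 S, is_kMARS e k S & #|S| = s) ->
  (forall S, is_kMARS e k S -> s <= #|S|) -> msad e k = Some s.
Proof.
move=> [S kS Ss] le; rewrite /msad; have -> : [exists S, is_kMARS e k S].
  by apply/existsP; exists S.
congr Some; apply/bigminn_eqP; [by exists S | by move=> *; apply: max_card|].
by split => //; exists S.
Qed.

Lemma msad_None k : (forall S, ~~ is_kMARS e k S) -> msad e k = None.
Proof. by move=> no; rewrite /msad ifN //; apply/existsPn. Qed.

End Diameter2.

(** * Counting gaps in cyclic words *)

Lemma big_ord_shift (f : nat -> nat) m :
  f m = f 0 -> \sum_(i < m) f i.+1 = \sum_(i < m) f i.
Proof.
move=> fm; have : \sum_(i < m.+1) f i = f 0 + \sum_(i < m) f i.+1 by rewrite big_ord_recl.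
by rewrite big_ord_recr /= fm addnC => /addnI.
Qed.

(* The word occupies positions 1, ..., m; positions 0 and m + 1 hold copies of
   its last and first letters. *)
Definition gapcount (m : nat) (x : nat -> bool) (j : nat) : nat :=
  \sum_(i < m) (~~ x i.+1 && (x i + x i.+2 == j)).

Section CyclicWord.
Variables (m : nat) (x : nat -> bool).
Hypotheses (x0 : x 0 = x m) (x1 : x m.+1 = x 1).

Lemma gapcount_total : \sum_(i < m) x i.+1 +
  (gapcount m x 0 + gapcount m x 1 + gapcount m x 2) = m.
Proof.
rewrite /gapcount -!big_split /= -[RHS]card_ord -sum1_card.
by apply: eq_bigr => i _; case: (x i); case: (x i.+1); case: (x i.+2).
Qed.

(* Both sides count the boundary edges of the set of true positions. *)
Lemma gapcount_boundary : gapcount m x 1 + 2 * gapcount m x 2 =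
  2 * \sum_(i < m) (x i && ~~ x i.+1).
Proof.
(* Around a cycle there are as many descents from true to false as ascents back. *)
have eqB : \sum_(i < m) (x i && ~~ x i.+1) = \sum_(i < m) (~~ x i && x i.+1).
  apply: (@addnI (\sum_(i < m) x i.+1)).
  rewrite {2}(@big_ord_shift (fun i => x i)) ?x0 // -!big_split /=.
  by apply: eq_bigr => i _; case: (x i); case: (x i.+1).
(* The ascents are shifted by one place, so that both kinds of edge are charged to the false letter
   [x i.+1]. *)
rewrite [RHS]mul2n -[RHS]addnn {2}eqB -(@big_ord_shift (fun i => ~~ x i && x i.+1)); last first.
  by rewrite x0 x1.
rewrite /gapcount big_distrr -!big_split /=.
by apply: eq_bigr => i _; case: (x i); case: (x i.+1); case: (x i.+2).
Qed.

(** Distinct gaps are opened by distinct true letters. *)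
Lemma gapcount_boundary_le : \sum_(i < m) (x i && ~~ x i.+1) <= \sum_(i < m) x i.+1.
Proof.
rewrite (@big_ord_shift (fun i => x i)) ?x0 //.
by apply: leq_sum => i _; case: (x i); case: (x i.+1).
Qed.

(** Without a false letter having exactly one true neighbour, two consecutive false letters force
    the next one to be false, and so on around the cycle. *)
Lemma gapcount1_eq0 : 0 < gapcount m x 0 -> gapcount m x 1 = 0 -> gapcount m x 0 = m.
Proof.
move=> c0 c1.
have step i : i < m -> ~~ x i -> ~~ x i.+1 -> ~~ x i.+2.
  move=> im /negPf xi /negPf xi1; move/eqP: c1; rewrite sum_nat_eq0 => /forallP/(_ (Ordinal im)).
  by rewrite /= xi xi1; case: (x _).
have run i j : i + j <= m -> ~~ x i -> ~~ x i.+1 -> ~~ x (i + j) /\ ~~ x (i + j).+1.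
  elim: j => [|j IH] ijm xi xi1; first by rewrite addn0.
  have [|h1 h2] := IH _ xi xi1; first by lia.
  by rewrite addnS; split=> //; apply: step => //; lia.
have [i] : exists i : 'I_m, ~~ x i.+1 && (x i + x i.+2 == 0).
  apply/existsP; apply: contraTT c0 => /existsPn no.
  by rewrite lt0n negbK sum_nat_eq0; apply/forallP => i; rewrite eqb0 no.
case/andP=> xi1 /eqP s0.
have xi : ~~ x i by case: (x i) s0.
(* The run reaches position [m], a copy of position 0, and restarts there to cover the whole
   cycle. *)
have [] := run i (m - i) _ xi xi1; first by have := ltn_ord i; lia.
rewrite subnKC; last exact: ltnW.
rewrite -x0 x1 => z0 z1.
have z j : j <= m -> ~~ x j /\ ~~ x j.+1 by move=> jm; apply: (run 0 j).
rewrite /gapcount -[RHS]card_ord -sum1_card; apply: eq_bigr => j _.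
have [/negPf-> /negPf h] := z _ (ltnW (ltn_ord j)).
by have [_ /negPf->] := z _ (ltn_ord j); rewrite h.
Qed.

End CyclicWord.

(** * Classes of rim vertices in the wheel *)

Section Wheel.
Variable m : nat.
Hypothesis m_gt5 : 5 < m.
Local Notation V := 'I_m.+1.
Local Notation W := (wheel m.+1).
Implicit Types (S : {set V}) (v : V).

(* Rim position i, for 0 <= i <= m + 1, with 0 and m + 1 wrapping around. *)
Definition rim (i : nat) : V :=
  inord (if i == 0 then m else if i == m.+1 then 1 else i).

Lemma val_rim i : i <= m.+1 ->
  rim i = (if i == 0 then m else if i == m.+1 then 1 else i) :> nat.
Proof. by move=> im; rewrite inordK //; do 2?case: eqP; lia. Qed.

Lemma rim_ord (i : 'I_m) : rim i.+1 = lift ord0 i.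
Proof.
apply: ord_inj; rewrite [RHS]/= val_rim ?ltnS 1?ltnW //=.
by rewrite ifN // eqSS ltn_eqF.
Qed.

Lemma rim_wrap : rim 0 = rim m /\ rim m.+1 = rim 1.
Proof.
split; apply: ord_inj; rewrite !val_rim; try lia.
all: by rewrite eqxx /=; do ?case: ifP; lia.
Qed.

Lemma wheel_sym : symmetric W.
Proof. by move=> u v; rewrite /wheel /= eq_sym; congr (_ && _); lia. Qed.

Lemma wheel_hub v : W ord0 v = (v != ord0).
Proof. by rewrite /wheel /= eq_sym andbT. Qed.

Lemma wheel_rim v u : v != ord0 ->
  W v u = (u \in ord0 |: (rim v.-1 |: [set rim v.+1])).
Proof.
move=> v0; rewrite !inE -!val_eqE /= !val_rim; try by have := ltn_ord v; lia.
have := ltn_ord v; have := ltn_ord u; move: v0.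
rewrite /wheel /Defs.cycle_next /= -!val_eqE /=.
move: (nat_of_ord u) (nat_of_ord v) => a b.
by do 3?case: ifP; lia.
Qed.

Lemma wheel_diam2 u v : u != v -> ~~ W u v -> exists2 w, W u w & W w v.
Proof.
move=> uv nuv; exists ord0; first rewrite wheel_sym; rewrite wheel_hub.
  by apply: contraNneq nuv => u0; rewrite u0 wheel_hub eq_sym -u0.
by apply: contraNneq nuv => v0; rewrite v0 wheel_sym wheel_hub -v0.
Qed.

Lemma wheel_card : 2 < #|V|.
Proof. by rewrite card_ord; lia. Qed.

Lemma nbrs_rim S v : v != ord0 ->
  nbrs W S v = (ord0 \in S) + (rim v.-1 \in S) + (rim v.+1 \in S).
Proof.
move=> v0; have v0' : 0 < v by rewrite lt0n.
have := ltn_ord v => vm.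
rewrite /nbrs -sum1_card.
transitivity (\sum_(s in ord0 |: (rim v.-1 |: [set rim v.+1])) (s \in S)).
  rewrite big_mkcond [RHS]big_mkcond; apply: eq_bigr => s _.
  by rewrite -wheel_rim // inE; case: (s \in S); case: (W v s).
have hub : ord0 \notin rim v.-1 |: [set rim v.+1].
  by rewrite !inE -!val_eqE /= !val_rim; try lia; do ?case: ifP; lia.
have prev : rim v.-1 \notin [set rim v.+1].
  by rewrite !inE -!val_eqE /= !val_rim; try lia; do ?case: ifP; lia.
by rewrite big_setU1 // big_setU1 // big_set1 /= addnA.
Qed.

Lemma kMARS_hub k S : 3 < k -> is_kMARS W k S -> ord0 \in S.
Proof.
move=> k3 /(is_kMARSP wheel_card wheel_diam2)[/set0Pn[s sS] _ lek].
apply: contraTT k3 => hubS; rewrite -leqNgt; apply: leq_trans (lek _ hubS) _.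
have s0 : s != ord0 by apply: contraNneq hubS => <-.
have -> : 3 = (1 + (1 + 1)) by [].
apply: (@leq_trans #|ord0 |: (rim s.-1 |: [set rim s.+1])|); last first.
  by rewrite !cardsU1 cards1 !leq_add ?leq_b1.
apply/subset_leq_card/subsetP => y; rewrite inE -wheel_rim // => /andP[yS /eqP yn].
(* The hub is adjacent to all of [S]; a vertex [y] of its class has equally many neighbours in [S],
   hence also all of [S]. *)
have all_nbr : [set t in S | W y t] = S.
  apply/eqP; rewrite eqEcard; apply/andP; split; first by apply/subsetP => t; rewrite inE; case/andP.
  rewrite -/(nbrs W S y) yn; apply/subset_leq_card/subsetP => t tS; rewrite inE tS wheel_hub.
  by apply: contraNneq hubS => <-.
by move: sS; rewrite -{1}all_nbr inE wheel_sym => /andP[].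
Qed.

Section Hub.
Variable S : {set V}.
Hypothesis hubS : ord0 \in S.
Let x i := rim i \in S.

Lemma card_hub : #|S| = (\sum_(i < m) x i.+1).+1.
Proof.
rewrite -sum1_card big_mkcond big_ord_recl /= hubS add1n; congr _.+1.
by apply: eq_bigr => i _; rewrite /x rim_ord; case: (_ \in S).
Qed.

(** The hub is one neighbour in [S] of every rim vertex, which accounts for the shift from [j] to
    [j.+1]. *)
Lemma card_class j : #|[set y | (y \notin S) && (nbrs W S y == j.+1)]| = gapcount m x j.
Proof.
rewrite -sum1_card big_mkcond big_ord_recl /= inE hubS add0n.
apply: eq_bigr => i _; rewrite inE nbrs_rim // hubS /x rim_ord.
have -> : lift ord0 i = i.+1 :> nat by [].
by rewrite -addnA add1n eqSS; case: (_ \in S); case: (_ == j).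
Qed.

Lemma msize_hub v : v \notin S ->
  exists2 j, j < 3 & nbrs W S v = j.+1 /\ msize W S v = gapcount m x j.
Proof.
move=> vS; have v0 : v != ord0 by apply: contraNneq vS => ->.
exists (x v.-1 + x v.+1); first by case: (x _); case: (x _).
have e : nbrs W S v = (x v.-1 + x v.+1).+1 by rewrite nbrs_rim // hubS.
by split=> //; rewrite -card_class /msize e.
Qed.

(** A zero count is an empty set and not a class, so the lower bound concerns positive counts
    only. *)
Lemma kMARS_gapcount k : 0 < k -> is_kMARS W k S <->
  (exists2 j, j < 3 & gapcount m x j = k) /\
  (forall j, j < 3 -> 0 < gapcount m x j -> k <= gapcount m x j).
Proof.
move=> k0.
have wit j : 0 < gapcount m x j -> exists2 v, v \notin S & msize W S v = gapcount m x j.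
  rewrite -card_class card_gt0 => /set0Pn[v]; rewrite inE => /andP[vS /eqP vj].
  by exists v => //; rewrite /msize vj.
split=> [/(is_kMARSP wheel_card wheel_diam2)[_ [v vS vk] lek]|[[j j3 jk] lek]].
  split; first by have [j j3 [_ jv]] := msize_hub vS; exists j; rewrite -?jv.
  by move=> j j3 /wit[u uS <-]; apply: lek.
apply/(is_kMARSP wheel_card wheel_diam2); split.
- by apply/set0Pn; exists ord0.
- by rewrite -jk; apply: wit; rewrite jk.
- move=> v vS; have [i i3 [vi iv]] := msize_hub vS; rewrite iv; apply: lek => //.
  by rewrite -iv card_gt0; apply/set0Pn; exists v; rewrite inE vS /=.
Qed.

End Hub.
End Wheel.

(** * Words with prescribed gaps *)

(* Computes gapcount on a list: x is the letter on its left, and the letter on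
   its right is taken to be true. *)
Fixpoint wgap (j : nat) (x : bool) (w : seq bool) : nat :=
  if w is b :: w' then (~~ b && (x + head true w' == j)) + wgap j b w' else 0.

(** The default [true] of [nth] supplies the letter to the right of the last one. *)
Lemma gapcount_wgap j y w : gapcount (size w) (nth true (y :: w)) j = wgap j y w.
Proof.
rewrite /gapcount; elim: w y => [|b w IH] y; first by rewrite big_ord0.
by rewrite big_ord_recl /= -IH -nth0.
Qed.

Lemma wgap_head j x y w : head true w -> wgap j x w = wgap j y w.
Proof. by case: w => [//|[]]. Qed.

Lemma wgap_ones j x t : wgap j x (nseq t true) = 0.
Proof. by elim: t x => //= t IH x; rewrite IH. Qed.

Lemma wgap_zeros j r w :
  wgap j false (ncons r false (false :: w)) = r * (0 == j) + wgap j false (false :: w).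
Proof.
elim: r => // r IH; rewrite mulSn -addnA -IH.
by case: r {IH}.
Qed.

Definition unit_gaps q w := iter q (fun w => true :: false :: w) w.
Definition double_gaps p w := iter p (fun w => [:: true, false, false & w]) w.

(** The claim on the head is carried through the induction because the count for a block depends on
    the letter after it. *)
Lemma unit_gapsP q w : head true w -> head true (unit_gaps q w) /\
  forall j, wgap j true (unit_gaps q w) = q * (2 == j) + wgap j true w.
Proof.
move=> hw; elim: q => [//|q [hq IH]]; split=> // j /=.
by rewrite hq mulSn -addnA -IH (wgap_head _ _ true).
Qed.

Lemma double_gapsP p w : head true w -> head true (double_gaps p w) /\
  forall j, wgap j true (double_gaps p w) = 2 * p * (1 == j) + wgap j true w.
Proof.
move=> hw; elim: p => [//|p [hp IH]]; split=> // j /=.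
by rewrite hp (wgap_head j false true hp) IH addn0 add0n; case: (1 == j); lia.
Qed.

(** Writing 1 for true, the word consists of [q] blocks 10, one block 100 with [r] further zeros,
    [p - 1] blocks 100, and [t] ones; for [p = 0] also [r = 0] and no long block occurs. *)
Lemma gap_word p q r t : (0 < r -> 0 < p) -> exists w,
  [/\ head true w, size w = t + 2 * q + 3 * p + r, count id w = t + p + q &
   forall j, wgap j true w = r * (0 == j) + 2 * p * (1 == j) + q * (2 == j)].
Proof.
have sz_u n w : size (unit_gaps n w) = 2 * n + size w.
  by elim: n => //= n ->; rewrite mulnS.
have sz_d n w : size (double_gaps n w) = 3 * n + size w.
  by elim: n => //= n ->; rewrite mulnS.
have ct_u n w : count id (unit_gaps n w) = n + count id w by elim: n => //= n ->.
have ct_d n w : count id (double_gaps n w) = n + count id w by elim: n => //= n ->.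
have h1 : head true (nseq t true) by case: (t).
case: p => [|p] rp.
  have -> : r = 0 by case: (r) rp => // r' /(_ isT).
  exists (unit_gaps q (nseq t true)); have [h hj] := unit_gapsP q h1.
  rewrite sz_u ct_u size_nseq count_nseq /=; split=> //; try lia.
  move=> j; rewrite hj wgap_ones; lia.
have [h2 h2j] := double_gapsP p h1.
pose w := true :: false :: ncons r false (false :: double_gaps p (nseq t true)).
have hw : head true w by [].
exists (unit_gaps q w); have [h hj] := unit_gapsP q hw.
rewrite sz_u ct_u /= -!cat_nseq !size_cat !count_cat !size_nseq !count_nseq /=.
rewrite sz_d ct_d size_nseq count_nseq /=; split=> //; try lia.
move=> j; rewrite hj /w /= wgap_zeros /= h2 (wgap_head _ false true) // h2j wgap_ones.
have -> : head true (ncons r false (false :: double_gaps p (nseq t true))) = false.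
  by case: (r).
by lia.
Qed.

(** * Types of antiresolving sets *)

(* p gaps of length >= 2, q gaps of length 1, r vertices without rim neighbour in S. *)
Definition wheel_type (n k s p q r : nat) : Prop :=
  n = s + 2 * p + q + r /\ p + q < s /\ (0 < r -> 0 < p) /\
  (k = 2 * p \/ k = q \/ k = r) /\
  (0 < p -> k <= 2 * p) /\ (0 < q -> k <= q) /\ (0 < r -> k <= r).

Lemma kMARS_wheel_type m k (S : {set 'I_m.+1}) : 5 < m -> 3 < k -> k < m ->
  is_kMARS (wheel m.+1) k S -> exists p q r, wheel_type m.+1 k #|S| p q r.
Proof.
move=> m5 k3 km kS; have hubS := kMARS_hub m5 k3 kS.
move/(kMARS_gapcount m5 hubS): kS => /(_ (ltnW (ltnW (ltnW k3)))).
rewrite (card_hub m5 hubS); set x := fun i => rim m i \in S.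
have [x0 x1] : x 0 = x m /\ x m.+1 = x 1 by rewrite /x; have [-> ->] := rim_wrap m5.
case=> -[j j3 jk] lek.
have tot := gapcount_total m x; have bd := gapcount_boundary x0 x1.
have bl := gapcount_boundary_le x0; have c10 := gapcount1_eq0 x0 x1.
have l0 := lek 0 isT; have l1 := lek 1 isT; have l2 := lek 2 isT.
(* Descents count all gaps, so removing those of length 1 leaves the long ones. *)
exists (\sum_(i < m) (x i && ~~ x i.+1) - gapcount m x 2), (gapcount m x 2), (gapcount m x 0).
have jk' : gapcount m x 0 = k \/ gapcount m x 1 = k \/ gapcount m x 2 = k.
  by case: j j3 jk => [|[|[|]]] // _ ->; auto.
rewrite /wheel_type.
move: (gapcount m x 0) (gapcount m x 1) (gapcount m x 2) (\sum_(i < m) (x i && ~~ x i.+1))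
  (\sum_(i < m) x i.+1) tot bd bl c10 l0 l1 l2 jk' => c0 c1 c2 b a.
(* [k < m] excludes the set consisting of the hub alone, where [r = m] and [p = 0]. *)
by clear -k3 km; lia.
Qed.

Lemma wheel_type_kMARS m k s p q r : 5 < m -> 0 < k -> wheel_type m.+1 k s p q r ->
  exists2 S : {set 'I_m.+1}, is_kMARS (wheel m.+1) k S & #|S| = s.
Proof.
move=> m5 k0 [ns [pqs [rp [keq [kp [kq kr]]]]]].
(* Of the [s] elements, one is the hub and [p + q] open a gap; the others form the final run of
   ones. *)
have [w [hw sz ct wj]] := gap_word q (s - (p + q).+1) rp.
have szm : size w = m by lia.
(* Position 0 repeats the last letter; the default at [m.+1] agrees with the first letter, which is
   true. *)
pose y := nth true (last true w :: w).
pose S : {set 'I_m.+1} := [set v | (v == ord0) || y v].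
have hubS : ord0 \in S by rewrite inE eqxx.
have y1 : y 1 by rewrite /y; case: (w) hw.
have ym : y m.+1 by rewrite /y nth_default //= szm.
have xy i : i <= m.+1 -> (rim m i \in S) = y i.
  move=> im; rewrite inE -val_eqE /= val_rim //.
  case: (i =P 0) => [->|i0].
    rewrite /y /= -nth_last szm; case: (m) m5 => //.
  case: (i =P m.+1) => [->|im1]; first by rewrite y1 ym.
  by case: eqP.
have gE j : gapcount m (fun i => rim m i \in S) j = wgap j true w.
  rewrite -(wgap_head j (last true w) true hw) -gapcount_wgap szm.
  by apply: eq_bigr => i _; rewrite !xy //; have := ltn_ord i; lia.
exists S.
  apply/(kMARS_gapcount m5 hubS k0); split.
    by case: keq => [|[|]] ->; [exists 1|exists 2|exists 0] => //; rewrite gE wj /=; lia.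
  by case=> [|[|[|]]] // _; rewrite gE wj /=; lia.
rewrite (card_hub m5 hubS).
have -> : \sum_(i < m) (rim m i.+1 \in S) = count id w.
  transitivity (\sum_(i < m) nth true w i).
    by apply: eq_bigr => i _; rewrite xy // ltnS ltnW.
  rewrite -sum1_count [RHS]big_mkcond [RHS](big_nth true) szm big_mkord.
  by apply: eq_bigr => i _; case: nth.
by rewrite ct; lia.
Qed.

(** * Minimising the cardinality over all types *)

Theorem theorem17 (n k : nat) (hn : 7 <= n) :
  (~~ odd k -> 4 <= k -> k < n - 1 ->
     msad (wheel n) k =
       if (5 * k + 2) %/ 2 <= n then Some ((k + 2) %/ 2)
       else if (3 * k + 2) %/ 2 <= n then Some (n - k)
       else None)
  /\
  (odd k -> 5 <= k -> k < n - 1 ->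
     msad (wheel n) k =
       if (5 * k + 5) %/ 2 <= n then
         Some (minn ((n - 1 - k) %/ 3 + (n - 1 - k) %% 3 + 1)
                    ((3 * k + 3) %/ 2))
       else if 2 * k < n then Some (n - k)
       else None).
Proof.
case: n hn => // m m5; rewrite subn1 /=.
have someP s p q r : 3 < k -> k < m -> wheel_type m.+1 k s p q r ->
    (forall s' p' q' r', wheel_type m.+1 k s' p' q' r' -> s <= s') ->
    msad (wheel m.+1) k = Some s.
  move=> k3 km ex le; apply: msad_Some => [|S].
    by apply: wheel_type_kMARS ex => //; lia.
  by case/(kMARS_wheel_type m5 k3 km) => p' [q' [r']] /le.
have noneP : 3 < k -> k < m -> (forall s p q r, ~ wheel_type m.+1 k s p q r) ->
    msad (wheel m.+1) k = None.
  move=> k3 km no; apply: msad_None => S; apply/negP.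
  by case/(kMARS_wheel_type m5 k3 km) => p [q [r]] /no.
split=> [ek|ok] kge km.
  have [h kE] : exists h, k = 2 * h by exists k./2; lia.
  rewrite /wheel_type in someP noneP.
  case: leqP => [big|small].
    (* With [h] long gaps and [s = h + 1], the remaining [r] vertices number at least [k] exactly
       when [n >= 5 * h + 1]. *)
    by apply: (someP _ h 0 (m.+1 - 3 * h - 1)); lia.
  (* Two classes no longer fit, so the only class has [k] elements and [s = n - k]. *)
  case: leqP => [mid|no]; first by apply: (someP _ h 0 0); lia.
  by apply: noneP; lia.
have [h kE] : exists h, k = 2 * h + 1 by exists k./2; lia.
rewrite /wheel_type in someP noneP.
case: (leqP ((5 * k + 5) %/ 2)) => [big|small].
  have := divn_eq (m - k) 3; have := ltn_pmod (m - k) (isT : 0 < 3).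
  move: ((m - k) %/ 3) ((m - k) %% 3) => f t t3 fE.
  rewrite /minn; case: ltnP => cmp.
    (* As [2 * p] is even, [k] is [q] or [r]. For [r = k] and [q = 0], [s = n - k - 2 * p] is least
       at the largest possible [p], namely [f]. *)
    by apply: (someP _ f 0 k); lia.
  (* For [q = k], the fewest long gaps are [h.+1], and [s = p + q + 1]; [cmp] makes [n] large enough
     for [r >= k]. *)
  by apply: (someP _ h.+1 k (m.+1 - (3 * k + 3) %/ 2 - 2 * h.+1 - k)); lia.
(* Only [k] short gaps remain possible, and [q < s] then means [2 * k < n]. *)
case: ltnP => [mid|no]; first by apply: (someP _ 0 k 0); lia.
by apply: noneP; lia.
Qed.
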